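(* Let $V:S\to S$ be a Volterra operator, $(V(x))_k=x_k\bigl(1+\sum_{i=1}^\infty a_{ki}x_i\bigr)$, such that $\mathbf Q\neq\emptyset$. Suppose $x^0\in S$ satisfies $x^0_i>0$ for all $i\in\mathbb N$, $V(x^0)\neq x^0$, and the limit $\lim_{n\to\infty}V^n(x^0)$ exists. Then $\lim_{n\to\infty}V^n(x^0)\in\mathbf Q$.
   Context: $S=\{x=(x_n)_{n\in\mathbb N}\in\ell^1 : x_n\ge 0,\ \sum_{n=1}^\infty x_n=1\}$. A Volterra operator is a map $V:S\to S$ of the form $(V(x))_k=x_k\bigl(1+\sum_{i=1}^\infty a_{ki}x_i\bigr)$, $k\in\mathbb N$, with $a_{ki}=-a_{ik}$, $|a_{ki}|\le1$ for all $k,i\in\mathbb N$. $V^n$ is the $n$-th iterate of $V$. Put $\mathbf Q=\{y\in S:\ \sum_{i=1}^\infty a_{ki}y_i\le 0\ \text{for all } k\in\mathbb N\}$. Limits are taken in $S$ with the $\ell^1$-norm topology (on $S$, this is the same as coordinatewise convergence to an element of $S$). *)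

(* Defs.v *)
From HB Require Import structures.
From mathcomp Require Import all_boot all_order all_algebra.
From mathcomp Require Import all_classical all_reals all_analysis.

Set Implicit Arguments.
Unset Strict Implicit.
Unset Printing Implicit Defensive.

Import Order.TTheory GRing.Theory Num.Theory.
Import numFieldNormedType.Exports.
Local Open Scope classical_set_scope.
Local Open Scope ring_scope.

(* Sequences are indexed from 0 instead of 1. *)

Definition ell1 (R : realType) : set (nat -> R) :=
  [set x | cvgn ([normed series x] : nat -> R)].

Definition ell1_norm (R : realType) (x : nat -> R) : R :=
  limn ([normed series x] : nat -> R).

Definition simplex (R : realType) : set (nat -> R) :=
  [set x | [/\ ell1 x, forall n, 0 <= x n & limn (series x) = 1]].

Arguments simplex R : clear implicits.

(* The series converges absolutely when the entries of [a] are bounded by 1 and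
   [x] lies in the simplex; elsewhere [limn] may return an arbitrary value. *)
Definition row_sum (R : realType) (a : nat -> nat -> R) (x : nat -> R)
    (k : nat) : R :=
  limn (series (fun i => a k i * x i)).

Definition is_volterra (R : realType) (a : nat -> nat -> R)
    (V : {fun simplex R >-> simplex R}) : Prop :=
  [/\ forall k i, a k i = - a i k,
      forall k i, `|a k i| <= 1 &
      forall x, simplex R x -> forall k, V x k = x k * (1 + row_sum a x k)].

Definition setQ (R : realType) (a : nat -> nat -> R) : set (nat -> R) :=
  [set y | simplex R y /\ forall k, row_sum a y k <= 0].

Definition ell1_cvg (R : realType) (u : nat -> nat -> R) (y : nat -> R) : Prop :=
  ell1_norm (fun i => u n i - y i) @[n --> \oo] --> (0 : R).

(* Main.v *)
Require Import Defs.
From HB Require Import structures.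
From mathcomp Require Import all_boot all_order all_algebra.
From mathcomp Require Import all_classical all_reals all_analysis.

Set Implicit Arguments.
Unset Strict Implicit.
Unset Printing Implicit Defensive.

Import Order.TTheory GRing.Theory Num.Theory.
Import numFieldNormedType.Exports.
Local Open Scope classical_set_scope.
Local Open Scope ring_scope.

(* A strictly positive coordinate x_k stays strictly positive under V, because
   the k-th row sum is at least x_k - 1 (the diagonal entry a_kk vanishes).  If
   the k-th row sum of the limit y were positive, then by l^1-continuity the
   k-th row sum along the orbit would eventually be nonnegative, so the k-th
   coordinate would eventually be nondecreasing and y_k > 0.  But y is a fixed
   point coordinatewise, y_k = y_k (1 + (A y)_k), which forces (A y)_k = 0. *)

Lemma term_le_lim_series (R : realType) (u : nat -> R) (k : nat) :
  (forall n, 0 <= u n) -> cvgn (series u) -> u k <= limn (series u).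
Proof.
move=> u0 cu.
have ndu : nondecreasing_seq (series u) by apply: nondecreasing_series => n _ _.
(* [series u n] sums the indices below [n], so [k.+1] is the first partial sum that contains
   [u k]. *)
apply: le_trans (nondecreasing_cvgn_le ndu cu k.+1).
by rewrite seriesSr lerDr /series/= sumr_ge0.
Qed.

Lemma norm_le_ell1_norm (R : realType) (x : nat -> R) (k : nat) :
  ell1 x -> `|x k| <= ell1_norm x.
Proof. by apply: (@term_le_lim_series _ (fun i => `|x i|)). Qed.

Lemma ell1B (R : realType) (x y : nat -> R) :
  ell1 x -> ell1 y -> ell1 (fun i => x i - y i).
Proof.
move=> cx cy; apply: (series_le_cvg _ _ _ (is_cvg_seriesD cx cy)) => n //=.
  by rewrite addr_ge0.
exact: ler_normB.
Qed.

Section RowSum.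
Variables (R : realType) (a : nat -> nat -> R).
Hypothesis a_le1 : forall k i, `|a k i| <= 1.

Lemma ell1_row (x : nat -> R) (k : nat) :
  ell1 x -> ell1 (fun i => a k i * x i).
Proof.
move=> cx; apply: (series_le_cvg _ _ _ cx) => n //=.
by rewrite normrM ler_piMl.
Qed.

Lemma row_sumB (x y : nat -> R) (k : nat) : ell1 x -> ell1 y ->
  row_sum a (fun i => x i - y i) k = row_sum a x k - row_sum a y k.
Proof.
move=> /(@ell1_row _ k)/normed_cvg cx /(@ell1_row _ k)/normed_cvg cy.
rewrite -lim_seriesB//; congr (limn (series _)).
by apply/funext => i; rewrite mulrBr.
Qed.

Lemma row_sum_le (x : nat -> R) (k : nat) :
  ell1 x -> `|row_sum a x k| <= ell1_norm x.
Proof.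
move=> ex; have ec := @ell1_row _ k ex.
apply: le_trans (lim_series_norm ec) _; apply: lim_series_le => // n /=.
by rewrite normrM ler_piMl.
Qed.

(** Since the coordinates sum to 1, the right-hand side is the series of [(1 + a k n) * x n]; its
    terms are nonnegative, and the one at [n = k] is [x k]. *)
Lemma le_row_sum (x : nat -> R) (k : nat) : a k k = 0 -> simplex R x ->
  x k <= 1 + row_sum a x k.
Proof.
move=> akk [ex x0 x1].
have cx := normed_cvg ex; have cr := normed_cvg (@ell1_row _ k ex).
rewrite -x1 -lim_seriesD//.
have -> : x k = (x + (fun i => a k i * x i)) k.
  by rewrite [RHS]/GRing.add/= akk mul0r addr0.
apply: term_le_lim_series; last exact: is_cvg_seriesD.
move=> n; rewrite -[_ n]/(x n + a k n * x n).
rewrite -[X in X + _]mul1r -mulrDl mulr_ge0// addrC -lerBlDr sub0r.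
by have := a_le1 k n; rewrite ler_norml => /andP[].
Qed.

End RowSum.

Lemma ell1_cvg_coord (R : realType) (u : nat -> nat -> R) (y : nat -> R) k :
  (forall n, ell1 (u n)) -> ell1 y -> ell1_cvg u y -> u n k @[n --> \oo] --> y k.
Proof.
move=> eu ey uy; apply/subr_cvg0/norm_cvg0P.
apply: (squeeze_cvgr _ (cvg_cst 0) uy).
by near=> n; rewrite normr_ge0/= (norm_le_ell1_norm k (ell1B (eu n) ey)).
Unshelve. all: by end_near. Qed.

(** Each row sum is linear and 1-Lipschitz for the l^1 norm, so the difference is squeezed between 0
    and [ell1_norm] of [u n - y]. *)
Lemma ell1_cvg_row_sum (R : realType) (a : nat -> nat -> R)
    (u : nat -> nat -> R) (y : nat -> R) k :
  (forall k i, `|a k i| <= 1) -> (forall n, ell1 (u n)) -> ell1 y ->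
  ell1_cvg u y -> row_sum a (u n) k @[n --> \oo] --> row_sum a y k.
Proof.
move=> a1 eu ey uy; apply/subr_cvg0/norm_cvg0P.
apply: (squeeze_cvgr _ (cvg_cst 0) uy).
by near=> n; rewrite normr_ge0/= -row_sumB// row_sum_le//; exact: ell1B.
Unshelve. all: by end_near. Qed.

Theorem theorem5p2 (R : realType) (a : nat -> nat -> R)
    (V : {fun simplex R >-> simplex R}) (hV : is_volterra a V)
    (hQ : setQ a !=set0)
    (x0 : nat -> R) (hx0 : simplex R x0) (x0_gt0 : forall i, 0 < x0 i)
    (hVx0 : V x0 <> x0)
    (y : nat -> R) (hy : simplex R y)
    (hlim : ell1_cvg (fun n => iter n V x0) y) :
  setQ a y.
Proof.
have [a_anti a_le1 VE] := hV.
have akk k : a k k = 0.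
  (* Antisymmetry on the diagonal gives [a k k *+ 2 = 0]. *)
  by apply/eqP; rewrite -[_ == _](mulrn_eq0 _ 2) mulr2n {1}a_anti addNr.
have Sx n : simplex R (iter n V x0) by elim: n => //= n; exact: funS.
have ex n : ell1 (iter n V x0) by have [] := Sx n.
have [ey _ _] := hy.
have x_gt0 n k : 0 < iter n V x0 k.
  elim: n => //= n IHn; rewrite VE// mulr_gt0//.
  exact: lt_le_trans IHn (le_row_sum a_le1 (akk k) (Sx n)).
split=> // k; rewrite leNgt; apply/negP => r_gt0.
have xy := @ell1_cvg_coord _ _ _ k ex ey hlim.
have ry := @ell1_cvg_row_sum _ _ _ _ k a_le1 ex ey hlim.
have y_fix : y k = y k * (1 + row_sum a y k).
  (* The shifted orbit has the same limit; passing to the limit in the formula for [V] computes it a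
     second time. *)
  have xSy : iter n.+1 V x0 k @[n --> \oo] --> y k.
    by rewrite (cvg_shiftS (fun n => iter n V x0 k)).
  apply: (cvg_unique _ xSy) => //=.
  under eq_fun do rewrite VE//.
  by apply: cvgM => //; apply: cvgD => //; exact: cvg_cst.
have [N _ r_ge0] := cvgr_ge _ ry _ r_gt0.
have x_ge n : (N <= n)%N -> iter N V x0 k <= iter n V x0 k.
  (* Induction on the number of steps after [N]: each one multiplies the coordinate by a factor at
     least 1. *)
  move=> /subnK <-; elim: (n - N)%N => //= m IHm.
  rewrite VE//; apply: le_trans IHm _.
  by rewrite ler_peMr ?(ltW (x_gt0 _ _))// lerDl; apply: r_ge0 => /=; rewrite leq_addl.
have y_gt0 : 0 < y k.
  apply: lt_le_trans (x_gt0 N k) _.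
  by apply: (cvgr_to_ge xy); exists N => // n /= /x_ge.
have : y k * row_sum a y k = 0.
  by apply: (addrI (y k)); rewrite addr0 [RHS]y_fix mulrDr mulr1.
by move/eqP; rewrite gt_eqF// mulr_gt0.
Qed.
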